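(* For every finite simple graph $G$ with adjacency matrix $A$ and diagonal degree matrix $D$, and all integers $\ell\ge 0$ and $a_0,\dots,a_\ell\ge 0$, $$\hom(C(a_0,\dots,a_\ell),G)=\mathbf 1^T D^{a_0}AD^{a_1}A\cdots AD^{a_\ell}\mathbf 1 .$$ Thus the monomial principal moments $\mathbf 1^Tw(A,D)\mathbf 1$ ($w$ a word in $x,y$) are precisely the homomorphism counts from the degree-decorated caterpillars $C(a_0,\dots,a_\ell)$, and the polynomial moments $\mathbf 1^Tw(A,D)\mathbf 1$, $w\in\mathbb R\langle x,y\rangle$, are their linear combinations.
   Context: $C(a_0,\dots,a_\ell)$ is the caterpillar obtained from the path (spine) $0-1-\cdots-\ell$ by attaching $a_i$ pendant leaves to the $i$-th spine vertex. $\hom(F,G)$ is the number of graph homomorphisms from $F$ to $G$ (adjacency-preserving maps $V(F)\to V(G)$). $\mathbf 1$ is the all-ones vector in $\mathbb R^{V(G)}$, and $D^0=I$. $\mathbb R\langle x,y\rangle$ is the algebra of real noncommutative polynomials in $x,y$, and $w(A,D)$ is evaluation at $x=A$, $y=D$. *)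

(* Defs.v *)
From HB Require Import structures.
From mathcomp Require Import all_boot all_order all_algebra.
From mathcomp Require Import finmap reals.
From mathcomp Require Export monalg.

Set Implicit Arguments.
Unset Strict Implicit.
Unset Printing Implicit Defensive.

Import GRing.Theory.
Local Open Scope ring_scope.

Record sgraph := SGraph {
  vertex :> finType;
  adj : rel vertex;
  adj_sym : symmetric adj;
  adj_irr : irreflexive adj
}.

Definition is_hom (F G : sgraph) (f : F -> G) : bool :=
  [forall u : F, forall v : F, adj u v ==> adj (f u) (f v)].

Definition hom_count (F G : sgraph) : nat :=
  #|[set f : {ffun F -> G} | is_hom f]|.

Section Caterpillar.
Variables (l : nat) (a : 'I_l.+1 -> nat).

(* [inl i] is the [i]-th spine vertex and [inr (Tagged _ k)], of tag [i], is the
   [k]-th of the [a i] leaves attached to it. *)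
Definition caterpillar_vertex : finType :=
  ('I_l.+1 + {i : 'I_l.+1 & 'I_(a i)})%type.

Definition caterpillar_adj (u v : caterpillar_vertex) : bool :=
  match u, v with
  | inl i, inl j => (i.+1 == j :> nat) || (j.+1 == i :> nat)
  | inl i, inr t | inr t, inl i => tag t == i
  | inr _, inr _ => false
  end.

Lemma caterpillar_adj_sym : symmetric caterpillar_adj.
Proof. by move=> [i|t] [j|s] //=; rewrite orbC. Qed.

Lemma caterpillar_adj_irr : irreflexive caterpillar_adj.
Proof. by move=> [i|t] //=; rewrite orbb gtn_eqF. Qed.

Definition caterpillar : sgraph :=
  SGraph caterpillar_adj_sym caterpillar_adj_irr.

End Caterpillar.

Section GraphMatrices.
Variables (R : nzRingType) (G : sgraph).

Definition degree (v : G) : nat := #|[set u : G | adj v u]|.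

Definition adjacency_mx : 'M[R]_#|G| :=
  \matrix_(i, j) (adj (enum_val i) (enum_val j))%:R.

Definition degree_mx : 'M[R]_#|G| :=
  diag_mx (\row_i (degree (enum_val i))%:R).

(* The scalar 1^T M 1. *)
Definition ones_form (M : 'M[R]_#|G|) : R :=
  ((const_mx 1 : 'cV[R]_#|G|)^T *m M *m (const_mx 1 : 'cV[R]_#|G|)) 0 0.

End GraphMatrices.

(* The free algebra R<x, y>, as the algebra of the free monoid on two letters:
   letter 0 stands for x and letter 1 for y. *)
Notation word := {fmonom 'I_2}.
Notation ncpoly R := {malg R[word]}.

Section NCEval.
Variables (R : comNzRingType) (n : nat) (X Y : 'M[R]_n).

Definition word_eval (w : word) : 'M[R]_n :=
  \prod_(i <- (w : seq 'I_2)) (if i == ord0 then X else Y).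

(* [mmap] does not apply: ['M_n] may be the zero ring, as [n = 0] is allowed. *)
Definition nceval (p : ncpoly R) : 'M[R]_n :=
  \sum_(w <- msupp p) p@_w *: word_eval w.

(* [nceval] is the unital algebra morphism sending x to [X] and y to [Y]. *)
Lemma ncevalEw (d : {fset word}) p :
  (msupp p `<=` d)%fset -> nceval p = \sum_(w <- d) p@_w *: word_eval w.
Proof.
move=> le; rewrite /nceval (big_fset_incl _ le) // => w _ /mcoeff_outdom ->.
by rewrite scale0r.
Qed.

Lemma ncevalU c w : nceval << c *g w >> = c *: word_eval w.
Proof. by rewrite (ncevalEw (msuppU_le)) big_seq_fset1 mcoeffUU. Qed.

Lemma ncevalD p q : nceval (p + q) = nceval p + nceval q.
Proof.
rewrite (ncevalEw (msuppD_le _ _)) (ncevalEw (fsubsetUl _ (msupp q))).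
rewrite (ncevalEw (fsubsetUr (msupp p) _)) -big_split /=.
by apply: eq_bigr => w _; rewrite mcoeffD scalerDl.
Qed.

Lemma ncevalZ c p : nceval (c *: p) = c *: nceval p.
Proof.
rewrite (ncevalEw (msuppZ_le _ _)) scaler_sumr.
by apply: eq_bigr => w _; rewrite mcoeffZ scalerA.
Qed.

Lemma nceval_sum I (s : seq I) F :
  nceval (\sum_(i <- s) F i) = \sum_(i <- s) nceval (F i).
Proof.
apply: big_morph; first exact: ncevalD.
by rewrite /nceval msupp0 big_seq_fset0.
Qed.

Lemma ncevalM p q : nceval (p * q) = nceval p * nceval q.
Proof.
rewrite malgME nceval_sum mulr_suml; apply: eq_bigr => v _.
rewrite nceval_sum mulr_sumr; apply: eq_bigr => w _.
rewrite ncevalU /word_eval fmM big_cat /=.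
by rewrite -[RHS]/(_ *m _) -scalemxAl -scalemxAr scalerA.
Qed.

Lemma nceval1 : nceval 1 = 1.
Proof. by rewrite ncevalU scale1r /word_eval fm1 big_nil. Qed.

Lemma nceval_x : nceval << fmu ord0 >> = X.
Proof. by rewrite ncevalU scale1r /word_eval fmU big_seq1. Qed.

Lemma nceval_y : nceval << fmu ord_max >> = Y.
Proof. by rewrite ncevalU scale1r /word_eval fmU big_seq1. Qed.

End NCEval.

Definition moment (R : comNzRingType) (p : ncpoly R) (G : sgraph) : R :=
  ones_form (nceval (adjacency_mx R G) (degree_mx R G) p).

(* Main.v *)
Require Import Defs.
From mathcomp Require Import all_boot all_order all_algebra finmap reals.

Set Implicit Arguments.
Unset Strict Implicit.
Unset Printing Implicit Defensive.

Import GRing.Theory.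
Local Open Scope ring_scope.

(** A homomorphism h from the caterpillar C(a_0, ..., a_l) to G is a walk
    f_0, ..., f_l in G, the image of the spine, together with an independent
    choice, for each of the a_i leaves at the i-th spine vertex, of a neighbour
    of f_i. So each walk extends to prod_i deg(f_i)^(a_i) homomorphisms, and the
    homomorphism count is the sum of these weights over all walks
    ([hom_count_caterpillarE]).

    On the other side, expanding 1^T D^a_0 (A D^a_1) ... (A D^a_l) 1 entrywise
    gives a sum over all sequences f_0, ..., f_l of vertices
    ([mulmx_prod_walk]). As D is diagonal, the term of f is the same weight
    prod_i deg(f_i)^(a_i) times prod_i A(f_i, f_(i+1)), and the latter is the
    indicator that f is a walk. Hence the two sides agree
    ([hom_count_caterpillar_mx]).

    A word in x and y is determined by the lengths of the maximal, possibly
    empty, blocks of y that its occurrences of x separate. So words are exactly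
    the y^a_0 x y^a_1 ... x y^a_l ([caterpillar_word_surj]), and the moments of
    words are the caterpillar counts. The claim on polynomials follows since
    p |-> 1^T p(A, D) 1 is linear and a polynomial is a finite linear
    combination of words. *)

(** * Sums over sequences of vertices *)

Definition ffun_cons (T : Type) l (x : T) (g : {ffun 'I_l -> T}) :
    {ffun 'I_l.+1 -> T} :=
  [ffun i => oapp g x (unlift ord0 i)].

Lemma ffun_cons0 (T : Type) l (x : T) (g : {ffun 'I_l -> T}) :
  ffun_cons x g ord0 = x.
Proof. by rewrite ffunE unlift_none. Qed.

Lemma ffun_consS (T : Type) l (x : T) (g : {ffun 'I_l -> T}) i :
  ffun_cons x g (lift ord0 i) = g i.
Proof. by rewrite ffunE liftK. Qed.

(** Peeling off the head of a sequence: this is the induction step of the walk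
    expansion below. *)
Lemma sum_ffun_cons (V : nmodType) (T : finType) l
    (F : {ffun 'I_l.+1 -> T} -> V) :
  \sum_f F f = \sum_(g : {ffun 'I_l -> T}) \sum_x F (ffun_cons x g).
Proof.
rewrite pair_bigA /=.
apply: (reindex (fun p : {ffun 'I_l -> T} * T => ffun_cons p.2 p.1)).
exists (fun f : {ffun 'I_l.+1 -> T} => ([ffun i : 'I_l => f (lift ord0 i)], f ord0)) => [[g x] _|f _] /=.
  by rewrite ffun_cons0; congr (_, _); apply/ffunP=> i; rewrite ffunE ffun_consS.
apply/ffunP=> i; case: (unliftP ord0 i) => [j ->|->].
  by rewrite ffun_consS ffunE.
by rewrite ffun_cons0.
Qed.

(** The transfer-matrix expansion. The initial weights form an arbitrary row
    [b] so that the induction can absorb the first matrix into it, as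
    [b *m M 0]. Here [inord i] is the tail of the [i]-th step and
    [lift ord0 i], of value [i.+1], is its head. *)
Lemma mulmx_prod_walk (R : nzRingType) n l (M : 'I_l -> 'M[R]_n) (b : 'rV_n) :
  (b *m (\prod_(i < l) M i) *m (const_mx 1 : 'cV_n)) 0 0 =
  \sum_(f : {ffun 'I_l.+1 -> 'I_n})
    b 0 (f ord0) * \prod_(i < l) M i (f (inord i)) (f (lift ord0 i)).
Proof.
elim: l => [|l IHl] in M b *.
  rewrite big_ord0 mulmx1 mxE.
  rewrite [RHS](reindex (fun x : 'I_n => [ffun=> x] : {ffun 'I_1 -> 'I_n})) /=.
    by apply: eq_bigr => x _; rewrite big_ord0 ffunE mxE.
  exists (fun f : {ffun 'I_1 -> _} => f ord0) => [x _|f _] /=; first by rewrite ffunE.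
  by apply/ffunP=> i; rewrite ffunE !ord1.
rewrite big_ord_recl -[_ * _]/(_ *m _) mulmxA IHl [RHS]sum_ffun_cons.
apply: eq_bigr => g _; rewrite mxE mulr_suml; apply: eq_bigr => x _.
rewrite big_ord_recl ffun_cons0 ffun_consS mulrA.
have -> : inord (@ord0 l) = ord0 :> 'I_l.+2 by apply/val_inj; rewrite /= inordK.
rewrite ffun_cons0; congr (_ * _); apply: eq_bigr => i _.
have -> : inord (lift ord0 i) = lift ord0 (inord i : 'I_l.+1) :> 'I_l.+2.
  have lt_il : (i < l.+1)%N := leqW (ltn_ord i).
  by apply/val_inj; rewrite /= !inordK.
by rewrite !ffun_consS.
Qed.

(** * Homomorphisms from a caterpillar *)

Section CaterpillarHom.
Variables (G : sgraph) (l : nat) (a : 'I_l.+1 -> nat).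

Definition is_walk (f : {ffun 'I_l.+1 -> G}) : bool :=
  [forall i : 'I_l, adj (f (inord i)) (f (lift ord0 i))].

Definition spine (h : {ffun caterpillar a -> G}) : {ffun 'I_l.+1 -> G} :=
  [ffun i => h (inl i)].

(** The edges of a caterpillar are those of the spine and those of the leaves,
    and the symmetry of [G] makes it enough to test each edge in one
    direction. *)
Lemma is_homE (h : {ffun caterpillar a -> G}) :
  is_hom h = is_walk (spine h) &&
    [forall t : {i : 'I_l.+1 & 'I_(a i)}, adj (h (inl (tag t))) (h (inr t))].
Proof.
have succ (i : 'I_l.+1) (j : 'I_l.+1) : i.+1 = j ->
    exists2 k : 'I_l, i = inord k & j = lift ord0 k.
  move=> ij; have lt_il : (i < l)%N by rewrite -ltnS ij.
  by exists (Ordinal lt_il); apply/val_inj; rewrite /= ?inordK.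
apply/idP/andP => [hom_h|[/forallP walk_h /forallP leaf_h]].
  have homP u v : adj u v -> adj (h u) (h v).
    by move/implyP: (forallP (forallP hom_h u) v).
  split; apply/forallP=> t; last by apply: homP; rewrite /= eqxx.
  by rewrite !ffunE; apply: homP; rewrite /= inordK ?eqxx //; apply: leqW.
apply/forallP=> u; apply/forallP=> v; apply/implyP.
case: u v => [i|t] [j|s] //=; last 2 first.
- by move/eqP <-.
- by move/eqP <-; rewrite adj_sym.
case/orP=> /eqP /succ[k -> ->].
  by have := walk_h k; rewrite !ffunE.
by rewrite adj_sym; have := walk_h k; rewrite !ffunE.
Qed.

(** Group the homomorphisms by the image of their spine. Those over a given
    walk [f] form the product of the sets [F u] of allowed images of each
    vertex [u]: the singleton of [f i] at the spine vertex [i], the neighbours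
    of [f i] at a leaf attached to it. *)
Lemma hom_count_caterpillarE :
  hom_count (caterpillar a) G =
  (\sum_(f | is_walk f) \prod_(i < l.+1) degree (f i) ^ a i)%N.
Proof.
rewrite /hom_count -sum1_card (partition_big spine is_walk); last first.
  by move=> h; rewrite inE is_homE => /andP[].
apply: eq_bigr => f walk_f.
pose F (u : caterpillar a) : pred G :=
  match u with inl i => pred1 (f i) | inr t => adj (f (tag t)) end.
rewrite (eq_bigl [in family F]) => [|h]; last first.
  rewrite inE is_homE; apply/andP/familyP => [[/andP[_ /forallP leaf_h]] | famh].
    by move/eqP=> spine_h [i|t]; rewrite unfold_in /= -spine_h ffunE /=.
  have spine_h : spine h = f.
    by apply/ffunP=> i; rewrite ffunE; apply/eqP/(famh (inl i)).
  rewrite spine_h walk_f eqxx; split=> //; apply/forallP=> t.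
  by have:= famh (inr t); rewrite unfold_in /= -spine_h ffunE.
rewrite sum1_card card_family foldrE big_map big_enum /= big_sumType /=.
rewrite big1 ?mul1n => [|i _]; last by rewrite card1.
transitivity (\prod_i \prod_(k < a i) degree (f i))%N.
  by rewrite sig_big_dep; apply: eq_bigr => t _; rewrite /degree cardsE.
by apply: eq_bigr => i _; rewrite prod_nat_const card_ord.
Qed.

End CaterpillarHom.

(** * Caterpillar counts as matrix products *)

Lemma diag_mxX (R : nzRingType) n (d : 'rV[R]_n) k :
  diag_mx d ^+ k = diag_mx (\row_i d 0 i ^+ k).
Proof.
elim: k => [|k IHk].
  rewrite expr0 -[1]/(1%:M) -diag_const_mx; congr diag_mx.
  by apply/rowP=> i; rewrite !mxE expr0.
rewrite exprS IHk -[_ * _]/(_ *m _) mulmx_diag; congr diag_mx.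
by apply/rowP=> i; rewrite !mxE exprS.
Qed.

(** Both sides are sums over sequences of vertices; the sequences that are not
    walks have a vanishing product of adjacency entries. *)
Lemma hom_count_caterpillar_mx (R : comNzRingType) (G : sgraph) l
    (a : 'I_l.+1 -> nat) (A := adjacency_mx R G) (D := degree_mx R G) :
  (hom_count (caterpillar a) G)%:R =
    ones_form (D ^+ a ord0 * \prod_(i < l) (A * D ^+ a (lift ord0 i))).
Proof.
rewrite /ones_form trmx_const -[_ * \prod_(i < l) _]/(_ *m _) mulmxA.
rewrite mulmx_prod_walk hom_count_caterpillarE natr_sum big_mkcond /=.
rewrite (reindex (fun f : {ffun 'I_l.+1 -> 'I_#|G|} =>
  [ffun i => enum_val (f i)] : {ffun 'I_l.+1 -> G})) /=; last first.
  exists (fun f : {ffun 'I_l.+1 -> G} => [ffun i => enum_rank (f i)]) => f _;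
    by apply/ffunP=> i; rewrite !ffunE (enum_valK, enum_rankK).
apply: eq_bigr => f _; rewrite diag_mxX mul_mx_diag !mxE mul1r.
(* The initial row is [1^T D ^+ a 0], so [f ord0] already carries its degree
   weight; each step contributes an adjacency entry and the weight of its head. *)
have entryE (i : 'I_l) :
    (A * D ^+ a (lift ord0 i)) (f (inord i)) (f (lift ord0 i)) =
    (adj (enum_val (f (inord i))) (enum_val (f (lift ord0 i))))%:R *
    (degree (enum_val (f (lift ord0 i))))%:R ^+ a (lift ord0 i).
  by rewrite diag_mxX -[_ * _]/(_ *m _) mul_mx_diag !mxE.
rewrite (eq_bigr _ (fun i _ => entryE i)) big_split /= mulrCA.
rewrite -(big_ord_recl _ (fun i => (degree (enum_val (f i)))%:R ^+ a i)) /=.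
have -> : \prod_(i < l)
    (adj (enum_val (f (inord i))) (enum_val (f (lift ord0 i))))%:R =
    (is_walk [ffun i => enum_val (f i)])%:R :> R.
  rewrite /is_walk; case: (boolP [forall _, _]) => [/forallP walk_f|/forallPn[i]].
    by rewrite big1 // => i _; have := walk_f i; rewrite !ffunE => ->.
  by rewrite !ffunE => /negPf nadj; rewrite (bigD1 i) //= nadj mul0r.
case: is_walk; rewrite ?mul0r // mul1r natr_prod.
by apply: eq_bigr => i _; rewrite ffunE natrX.
Qed.

(** * Words and caterpillars *)

Definition caterpillar_word l (a : 'I_l.+1 -> nat) : word :=
  FMonom (nseq (a ord0) ord_max ++
    \big[cat/[::]]_(i < l) (ord0 :: nseq (a (lift ord0 i)) ord_max)).

Lemma word_eval_caterpillar (R : comNzRingType) n (X Y : 'M[R]_n) l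
    (a : 'I_l.+1 -> nat) :
  word_eval X Y (caterpillar_word a) =
    Y ^+ a ord0 * \prod_(i < l) (X * Y ^+ a (lift ord0 i)).
Proof.
have evalY k :
    \prod_(i <- nseq k (ord_max : 'I_2)) (if i == ord0 then X else Y) = Y ^+ k.
  by rewrite big_nseq /= iter_mulr_1.
rewrite /word_eval /= big_cat /= evalY; congr (_ * _).
rewrite (big_morph
  (fun s : seq 'I_2 => \prod_(i <- s) (if i == ord0 then X else Y))
  (fun s t => big_cat _ s t _ _) (big_nil _ _ _ _)).
by apply: eq_bigr => i _; rewrite big_cons /= evalY.
Qed.

(** Read the word from the left: a letter y adds a leaf to the first spine
    vertex, a letter x puts a new leafless vertex in front of the spine. *)
Lemma caterpillar_word_surj (w : word) :
  exists l (a : 'I_l.+1 -> nat), w = caterpillar_word a.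
Proof.
case: w => s; elim: s => [|i s [l [a [->]]]].
  by exists 0, (fun=> 0); rewrite /caterpillar_word big_ord0.
case: (unliftP ord0 i) => [j ->|->].
  exists l, (fun k => (k == ord0) + a k)%N; congr FMonom.
  by have -> : lift ord0 j = ord_max by apply/val_inj; rewrite /= ord1.
exists l.+1, (fun k => oapp a 0 (unlift ord0 k)); congr FMonom.
rewrite unlift_none big_ord_recl /= liftK; congr (_ :: (_ ++ _)).
by apply: eq_bigr => k _; rewrite liftK.
Qed.

Lemma moment_caterpillar (R : comNzRingType) (G : sgraph) l (a : 'I_l.+1 -> nat) :
  moment << caterpillar_word a >> G = (hom_count (caterpillar a) G)%:R :> R.
Proof.
by rewrite /moment ncevalU scale1r word_eval_caterpillar hom_count_caterpillar_mx.
Qed.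

Lemma moment_sum (R : comNzRingType) (G : sgraph) (I : Type) (s : seq I)
    (c : I -> R) (w : I -> word) :
  moment (\sum_(i <- s) c i *: << w i >>) G =
  \sum_(i <- s) c i * moment << w i >> G.
Proof.
rewrite /moment nceval_sum /ones_form mulmx_sumr mulmx_suml summxE.
by apply: eq_bigr => i _; rewrite ncevalZ -scalemxAr -scalemxAl mxE.
Qed.

Theorem proposition7p1 (R : realType) :
  (forall (G : sgraph) (l : nat) (a : 'I_l.+1 -> nat),
     let A := adjacency_mx R G in
     let D := degree_mx R G in
     (hom_count (caterpillar a) G)%:R =
       ones_form (D ^+ a ord0 * \prod_(i < l) (A * D ^+ a (lift ord0 i)))) /\
  (forall P : sgraph -> R,
     (exists w : word, forall G, P G = moment << w >> G) <->
     (exists (l : nat) (a : 'I_l.+1 -> nat),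
        forall G, P G = (hom_count (caterpillar a) G)%:R)) /\
  (forall P : sgraph -> R,
     (exists p : ncpoly R, forall G, P G = moment p G) <->
     (exists (n : nat) (c : 'I_n -> R) (l : 'I_n -> nat)
             (a : forall k : 'I_n, 'I_(l k).+1 -> nat),
        forall G, P G = \sum_(k < n) c k * (hom_count (caterpillar (a k)) G)%:R)).
Proof.
split; first by move=> G l a; apply: hom_count_caterpillar_mx.
split=> P; split.
- case=> w PE; have [l [a wE]] := caterpillar_word_surj w.
  by exists l, a => G; rewrite PE wE moment_caterpillar.
- case=> l [a PE]; exists (caterpillar_word a) => G.
  by rewrite PE moment_caterpillar.
- case=> p PE; pose s : seq word := msupp p.
  pose w (k : 'I_(size s)) := tnth (in_tuple s) k.
  have /fin_all_exists[l /fin_all_exists[a wE]] :=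
    fun k => caterpillar_word_surj (w k).
  exists (size s), (fun k => p@_(w k)), l, a => G.
  have pE : p = \sum_(v <- s) p@_v *: << v >>.
    rewrite {1}(monalgE p); apply: eq_bigr => v _; apply/malgP=> u.
    by rewrite mcoeffZ !mcoeffU mulr_natr.
  rewrite PE {1}pE moment_sum big_tnth; apply: eq_bigr => k _.
  by rewrite -/(w k) wE moment_caterpillar.
- case=> n [c [l [a PE]]].
  exists (\sum_k c k *: << caterpillar_word (a k) >>) => G.
  by rewrite PE moment_sum; apply: eq_bigr => k _; rewrite moment_caterpillar.
Qed.
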